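(* Let $R$ be a nonzero semiprimitive commutative ring with identity. Then $\mathrm{Max}(R)$ is disconnected if and only if $R$ is the direct sum of two proper ideals, i.e. there exist proper ideals $I,J$ of $R$ with $I+J=R$ and $I\cap J=\{0\}$.
   Context: $\mathrm{Max}(R)$ is the set of maximal ideals of $R$ with the Zariski (hull-kernel) topology, whose closed sets are the sets $\{M\in\mathrm{Max}(R): S\subseteq M\}$ for $S\subseteq R$. $R$ is semiprimitive if the intersection of all its maximal ideals is $\{0\}$. A space is disconnected if it has a nonempty proper clopen subset. *)

(* Defs.v *)
From HB Require Import structures.
From mathcomp Require Import all_boot all_order all_algebra.
From mathcomp Require Import all_classical topology.

Set Implicit Arguments.
Unset Strict Implicit.
Unset Printing Implicit Defensive.

Import GRing.Theory.

Local Open Scope classical_set_scope.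
Local Open Scope ring_scope.

(* [idealr R] is the type of proper ideals: 1 is excluded by definition.
   Membership is boolean, which loses no generality since [asbool] turns any
   predicate into a boolean one. *)

Definition ideal_set (R : comNzRingType) (I : idealr R) : set R :=
  [set x | x \in (I : {pred R})].

Definition maximal_ideal (R : comNzRingType) (M : idealr R) : Prop :=
  forall J : idealr R,
    ideal_set M `<=` ideal_set J -> ideal_set J = ideal_set M.

(* Two points with the same underlying set are equal: [max_ideal_inj]. *)
Record Max (R : comNzRingType) : Type := MaxIdeal {
  max_ideal :> idealr R;
  max_idealP : maximal_ideal max_ideal
}.

Definition semiprimitive (R : comNzRingType) : Prop :=
  \bigcap_(M in [set: Max R]) ideal_set M = [set 0].

Definition hull (R : comNzRingType) (S : set R) : set (Max R) :=
  [set M | S `<=` ideal_set M].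

Definition zariski_open (R : comNzRingType) : set_system (Max R) :=
  [set U | exists S : set R, ~` U = hull S].

Definition disconnected (T : topologicalType) : Prop :=
  exists U : set T, [/\ clopen U, U !=set0 & U <> [set: T]].

Definition direct_sum_of (R : comNzRingType) (I J : idealr R) : Prop :=
  [set x + y | x in ideal_set I & y in ideal_set J] = [set: R] /\
  ideal_set I `&` ideal_set J = [set 0].

Section MaxTopology.
Variable R : comNzRingType.

Lemma max_ideal_inj : injective (fun M : Max R => ideal_set M).
Proof.
move=> [I mI] [J mJ] /= IJ.
have e : I = J.
  case: I IJ {mI} => I cI; case: J {mJ} => J cJ IJ.
  have e : I = J.
    apply/funext => x; apply/idP/idP => Hx.
      by have : [set y | y \in (I : {pred R})] x by []; rewrite [X in X x]IJ.
    by have : [set y | y \in (J : {pred R})] x by []; rewrite -[X in X x]IJ.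
  case: J / e {IJ} cJ => cJ; congr Idealr.Pack.
  case: cI => [[a] [b] [c]]; case: cJ => [[a'] [b'] [c']].
  by rewrite (Prop_irrelevance a a') (Prop_irrelevance b b')
             (Prop_irrelevance c c').
by case: J / e mJ {IJ} => mJ; congr MaxIdeal; exact: Prop_irrelevance.
Qed.

Lemma max_ideal_prime (M : Max R) (a b : R) :
  ideal_set M (a * b) -> ideal_set M a \/ ideal_set M b.
Proof.
rewrite /ideal_set /= => Mab; apply/orP; apply: contraT.
rewrite negb_or => /andP[Ma Mb].
pose P : R -> bool := fun x =>
  `[< exists2 m, m \in (M : {pred R}) & exists r, x = m + r * a >].
have PM x : x \in (M : {pred R}) -> P x.
  by move=> Mx; apply/asboolP; exists x => //; exists 0; rewrite mul0r addr0.
have Pa : P a.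
  by apply/asboolP; exists 0; [exact: rpred0|exists 1; rewrite mul1r add0r].
have Pid : idealr_closed (P : {pred R}).
  split; first exact/PM/rpred0.
    apply: contra Mb => /asboolP[m Mm [r e]].
    rewrite -[b]mul1r e mulrDl rpredD //; first by rewrite mulrC idealMr.
    by rewrite -mulrA idealMr.
  move=> c x y /asboolP[m Mm [r ->]] /asboolP[n Mn [s ->]].
  apply/asboolP; exists (c * m + n); first by rewrite rpredD ?idealMr.
  by exists (c * r + s); rewrite mulrDr mulrDl mulrA addrACA.
pose J : idealr R := HB.pack P (isIdealr.Build R P Pid).
have JM : ideal_set J = ideal_set M.
  by apply: max_idealP => x; exact: PM.
have : ideal_set J a by exact: Pa.
by rewrite JM /ideal_set /= (negPf Ma).
Qed.

Lemma zariski_openT : @zariski_open R [set: Max R].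
Proof.
exists setT; apply/seteqP; split=> [M /(_ I)//|M /(_ 1 I)].
by rewrite /ideal_set /= idealr1.
Qed.

Lemma zariski_openI : setI_closed (@zariski_open R).
Proof.
move=> A B [S hS] [T hT]; exists [set s * t | s in S & t in T].
rewrite setCI hS hT; apply/seteqP; split=> M.
  case=> SM _ [s Ss [t Tt <-]]; last exact/idealMr/SM.
  by rewrite /ideal_set /= mulrC; exact/idealMr/SM.
move=> STM; apply: contrapT => /not_orP[/existsNP[s /not_implyP[Ss Ms]]].
move=> /existsNP[t /not_implyP[Tt Mt]].
have Mst : ideal_set M (s * t) by apply: STM; exists s => //; exists t.
by case: (max_ideal_prime Mst).
Qed.

Lemma zariski_open_bigU (D : Type) (f : D -> set (Max R)) :
  (forall i, zariski_open (f i)) -> zariski_open (\bigcup_i f i).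
Proof.
move=> /choice[S hS]; exists (\bigcup_i S i).
rewrite setC_bigcup; apply/seteqP; split=> M.
  by move=> fM x [i _ Six]; have := fM i I; rewrite hS; apply.
by move=> SM i _; rewrite hS => x Six; apply: SM; exists i.
Qed.

HB.instance Definition _ := gen_eqMixin (Max R).
HB.instance Definition _ := gen_choiceMixin (Max R).
HB.instance Definition _ := isOpenTopological.Build (Max R)
  zariski_openT zariski_openI zariski_open_bigU.

Lemma closed_MaxP (A : set (Max R)) :
  closed A <-> exists S : set R, A = hull S.
Proof.
rewrite -openC; change (zariski_open (~` A) <-> exists S : set R, A = hull S).
by rewrite /zariski_open /= setCK.
Qed.

End MaxTopology.

(* Main.v *)
Require Import Defs.
From HB Require Import structures.
From mathcomp Require Import all_boot all_order all_algebra.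
From mathcomp Require Import all_classical topology.

(** Closed sets of the maximal spectrum are hulls [V(S)], so both directions
    are translations between ideals and hulls.

    If [U] is clopen, nonempty and proper, the ideals are the kernels
    [I = k(U)] and [J = k(~U)], the intersections of the maximal ideals in [U]
    and in its complement.  They are proper because [U] and [~U] are nonempty.
    Their intersection lies in every maximal ideal, hence is zero by
    semiprimitivity.  They are comaximal because a maximal ideal above
    [I + J] would belong both to [V(k(U)) = U] and to [V(k(~U)) = ~U]: this is
    where the closedness of the two sets is used.

    Conversely, if [R] is the direct sum of [I] and [J], then [V(I)] and [V(J)]
    are complementary: no maximal ideal contains [I + J = R], and each one
    contains [I] or [J] by primality, since [IJ] is contained in the zero ideal
    [I :&: J].  So [V(I)] is clopen; it is nonempty and proper because [I] and
    [J] both lie in some maximal ideal.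

    Both directions rest on Krull's theorem [exists_max_ideal], that a proper
    ideal lies in a maximal one. *)

Set Implicit Arguments.
Unset Strict Implicit.
Unset Printing Implicit Defensive.

Import GRing.Theory.

Local Open Scope classical_set_scope.
Local Open Scope ring_scope.

Section IdealsAndHulls.
Variable R : comNzRingType.
Implicit Types (A B : set R) (U : set (Max R)).

(** Proper ideals as plain sets, so that unions of chains, sums and
    intersections can be formed before a bundled ideal is available. *)
Definition proper_ideal_set A : Prop :=
  [/\ A 0, ~ A 1 & forall a x y, A x -> A y -> A (a * x + y)].

Lemma ideal_set_proper (I : idealr R) : proper_ideal_set (ideal_set I).
Proof.
rewrite /ideal_set; split=> /= [||a x y Ix Iy]; first exact: rpred0.
  by rewrite idealr1.
by rewrite rpredD ?idealMr.
Qed.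

Lemma proper_ideal_setP A :
  proper_ideal_set A -> exists I : idealr R, ideal_set I = A.
Proof.
move=> [A0 A1 AD]; pose P : R -> bool := fun x => `[< A x >].
have Pid : idealr_closed (P : {pred R}).
  split; [exact/asboolP | exact/asboolPn |].
  by move=> a x y /asboolP Ax /asboolP Ay; apply/asboolP/AD.
pose I : idealr R := HB.pack P (isIdealr.Build R P Pid).
by exists I; apply/seteqP; split=> x; [move/asboolP | move=> ?; apply/asboolP].
Qed.

Lemma bigcup_chain_proper (F : set (set R)) :
  F !=set0 -> (forall A, F A -> proper_ideal_set A) -> total_on F subset ->
  proper_ideal_set (\bigcup_(A in F) A).
Proof.
move=> [A0 FA0] Fid Ftot; split.
- by exists A0 => //; case: (Fid _ FA0).
- by move=> [A FA A1]; case: (Fid _ FA).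
- move=> a x y [A FA Ax] [B FB By].
  have [AB|BA] := Ftot _ _ FA FB.
    by exists B => //; case: (Fid _ FB) => _ _; apply => //; exact: AB.
  by exists A => //; case: (Fid _ FA) => _ _; apply => //; exact: BA.
Qed.

(** Krull's theorem.  It guarantees that the maximal spectrum has enough
    points: an ideal is the whole ring as soon as its hull is empty. *)
Lemma exists_max_ideal A :
  proper_ideal_set A -> exists M : Max R, A `<=` ideal_set M.
Proof.
move=> Aid.
(* [Zorn_bigcup] also asks for the union of the empty chain, which is [set0]
   and not an ideal; ordering the sets [B] by the ideals [A `|` B] makes that
   union stand for [A] itself. *)
have [F FP Ftot|B [ABid Bmax]] :=
    @Zorn_bigcup _ [set B | proper_ideal_set (A `|` B)].
  rewrite /=; have [->|F0] := eqVneq F set0; first by rewrite bigcup_set0 setU0.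
  rewrite (_ : _ `|` _ = \bigcup_(C in [set A `|` B | B in F]) C).
    apply: bigcup_chain_proper.
    - by move/set0P: F0 => [B FB]; exists (A `|` B), B.
    - by move=> _ [B FB <-]; exact: FP.
    - move=> _ _ [B FB <-] [C FC <-].
      by have [BC|CB] := Ftot _ _ FB FC; [left | right]; exact: setUS.
  rewrite bigcup_image; apply/seteqP; split=> x.
    move/set0P: F0 => [B FB] [Ax|[C FC Cx]]; first by exists B => //; left.
    by exists C => //; right.
  by move=> [B FB [Ax|Bx]]; [left | right; exists B].
have [M eM] := proper_ideal_setP ABid.
have Mmax : maximal_ideal M.
  move=> J MJ; apply/seteqP; split=> // x Jx; apply: contrapT => Mx.
  have AJ : A `|` ideal_set J = ideal_set J.
    by apply/setUidPr => y Ay; apply: MJ; rewrite eM; left.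
  apply: (Bmax (ideal_set J)); last by rewrite /= AJ; exact: ideal_set_proper.
  split; first by move=> y By; apply: MJ; rewrite eM; right.
  by move=> JB; apply: Mx; rewrite eM; right; exact: JB.
by exists (MaxIdeal Mmax) => x Ax /=; rewrite eM; left.
Qed.

(** An ideal sum that is not the whole ring is proper, so a maximal ideal
    contains it. *)
Lemma comaximal_sum A B :
  proper_ideal_set A -> proper_ideal_set B -> hull A `&` hull B = set0 ->
  [set x + y | x in A & y in B] = [set: R].
Proof.
move=> [A0 _ AD] [B0 _ BD] AB0; set S := [set _ | _ in _ & _ in _].
have SD a x y : S x -> S y -> S (a * x + y).
  move=> [x1 Ax1 [x2 Bx2 <-]] [y1 Ay1 [y2 By2 <-]].
  exists (a * x1 + y1); first exact: AD.
  by exists (a * x2 + y2); [exact: BD | rewrite mulrDr addrACA].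
have S0 : S 0 by exists 0 => //; exists 0; rewrite // addr0.
have [S1|S1] := pselect (S 1).
  by apply/seteqP; split=> // x _; rewrite -[x]mulr1 -[_ * 1]addr0; exact: SD.
have [M SM] := exists_max_ideal (And3 S0 S1 SD).
suff : (hull A `&` hull B) M by rewrite AB0.
by split=> x Hx; apply: SM;
  [exists x => //; exists 0; rewrite // addr0
  |exists 0 => //; exists x; rewrite // add0r].
Qed.

Definition kernel U : set R := \bigcap_(M in U) ideal_set M.

Lemma kernel_proper U : U !=set0 -> proper_ideal_set (kernel U).
Proof.
move=> [M0 UM0]; split.
- by move=> M _; case: (ideal_set_proper M).
- by move=> /(_ M0 UM0); case: (ideal_set_proper M0).
- move=> a x y kx ky M UM; case: (ideal_set_proper M) => _ _.
  by apply; [exact: kx | exact: ky].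
Qed.

(** Hull and kernel form a Galois connection, whose fixed points on the
    topological side are the hulls, that is, the closed sets. *)
Lemma hull_kernel U : closed U -> hull (kernel U) = U.
Proof.
move=> /closed_MaxP[S US]; apply/seteqP; split=> M; last by move=> UM x; apply.
by move=> kM; rewrite US => x Sx; apply: kM => N; rewrite US; apply.
Qed.

(** Primality gives one inclusion, since [xy = 0] for [x] in [I] and [y] in
    [J]; comaximality gives the other. *)
Lemma direct_sum_setC_hull (I J : idealr R) :
  direct_sum_of I J -> ~` hull (ideal_set I) = hull (ideal_set J).
Proof.
move=> [IJT IJ0]; apply/seteqP; split=> M.
  move=> /existsNP[x /not_implyP[Ix Mx]] y Jy.
  have xy0 : x * y = 0.
    suff : (ideal_set I `&` ideal_set J) (x * y) by rewrite IJ0.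
    by split; [rewrite mulrC; exact: idealMr | exact: idealMr].
  have : ideal_set M (x * y) by rewrite xy0; case: (ideal_set_proper M).
  by case/max_ideal_prime.
move=> JM IM; have [x Ix [y Jy xy1]] :
  [set x + y | x in ideal_set I & y in ideal_set J] 1 by rewrite IJT.
case: (ideal_set_proper M) => _ + _; apply.
by rewrite -xy1; apply: rpredD; [exact: IM | exact: JM].
Qed.

End IdealsAndHulls.

Theorem theorem4p13 (R : comNzRingType) (hR : semiprimitive R) :
  disconnected (Max R) <-> exists I J : idealr R, direct_sum_of I J.
Proof.
split=> [[U [[Uo Uc] U0 UT]]|[I [J IJ]]].
  have CU0 : ~` U !=set0.
    by apply/set0P/eqP => CU; apply: UT; rewrite -[U]setCK CU setC0.
  have [I eI] := proper_ideal_setP (kernel_proper U0).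
  have [J eJ] := proper_ideal_setP (kernel_proper CU0).
  exists I, J; split; rewrite eI eJ.
    apply: comaximal_sum; [exact: kernel_proper | exact: kernel_proper |].
    by rewrite !hull_kernel ?setICr //; exact: open_closedC.
  by rewrite -hR -(setUv U) /kernel bigcap_setU.
have hC := direct_sum_setC_hull IJ.
have [M IM] := exists_max_ideal (ideal_set_proper I).
have [N JN] := exists_max_ideal (ideal_set_proper J).
exists (hull (ideal_set I)); split.
- split; last by apply/closed_MaxP; eexists.
  by rewrite -closedC hC; apply/closed_MaxP; eexists.
- by exists M.
- move=> IT; have : hull (ideal_set J) N by [].
  by rewrite -hC IT setCT.
Qed.
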